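(* Consider the following properties of a Borel poset $(P,\le)$: (a) Borel $\sigma$-finite chain condition; (b) Borel $\sigma$-bounded chain condition; (c$_n$) Borel $\sigma$-$n$-linkedness, for each integer $n\ge 2$; (d) Borel $\sigma$-centredness. These properties are pairwise distinct, i.e. the hierarchy is strict. Precisely: (1) there is a Borel poset satisfying the Borel $\sigma$-finite chain condition but not the Borel $\sigma$-bounded chain condition; (2) there is a Borel poset satisfying the Borel $\sigma$-bounded chain condition but which is not Borel $\sigma$-$2$-linked; (3) for every integer $n>2$ there is a Borel poset which is Borel $\sigma$-$(n-1)$-linked but not Borel $\sigma$-$n$-linked; (4) there is a Borel poset which is Borel $\sigma$-$n$-linked for every integer $n\ge 2$ but is not Borel $\sigma$-centred.
   Context: A Borel poset is a partial order $(P,\le)$ where $P$ is a Polish (or standard Borel) space and $\le$ is a Borel subset of $P^2$. For $A\subseteq P$ and an integer $n>1$: $A$ is $n$-linked if every subset $A'\subseteq A$ of size $n$ has a common lower bound $z\in P$ (i.e. $z\le x$ for all $x\in A'$); $A$ is linked if it is $2$-linked; $A$ is centred if it is $n$-linked for every $n>1$. Elements $x,y$ are compatible if $\{x,y\}$ is linked, incompatible otherwise; an antichain is a pairwise incompatible set. $P$ satisfies the Borel $\sigma$-finite chain condition if $P=\bigcup_n P_n$ for countably many Borel sets $P_n$ none of which contains an infinite antichain; $P$ satisfies the Borel $\sigma$-bounded chain condition if $P=\bigcup_n P_n$ for countably many Borel sets $P_n$ such that each $P_n$ contains no antichain of size $\ge n$ (equivalently, each $P_n$ has some finite bound on the sizes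 of its antichains); $P$ is Borel $\sigma$-$n$-linked if $P=\bigcup_k P_k$ for countably many Borel $n$-linked sets $P_k$; $P$ is Borel $\sigma$-centred if $P=\bigcup_k P_k$ for countably many Borel centred sets $P_k$. *)

(* Defs.v *)
From mathcomp Require Import all_boot all_order all_algebra.
From mathcomp Require Import all_classical all_reals all_analysis.

Set Implicit Arguments.
Unset Strict Implicit.
Unset Printing Implicit Defensive.

Import Order.TTheory GRing.Theory Num.Theory.

Local Open Scope classical_set_scope.
Local Open Scope card_scope.

Definition borel {T : topologicalType} (A : set T) : Prop := <<s @open T >> A.

Definition separable (T : topologicalType) : Prop :=
  exists2 D : set T, countable D & dense D.

(* The limit is existentially quantified, rather than expressed with [cvg],
   so that no point of the space is needed: the empty space is Polish. *)
Definition complete_space (M : uniformType) : Prop :=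
  forall F : set_system M, ProperFilter F -> cauchy F -> exists l : M, F --> l.

(* A metric compatible with the topology is given as a homeomorphism with a
   metric space, so that it is not part of the data of the Polish space. *)
Definition completely_metrizable (R : realType) (T : topologicalType) : Prop :=
  exists (M : metricType R) (f : T -> M) (g : M -> T),
    [/\ cancel f g, cancel g f, continuous f, continuous g & complete_space M].

Definition polish (R : realType) (T : topologicalType) : Prop :=
  separable T /\ completely_metrizable R T.

(* [POrderedTopological] imposes no compatibility between order and topology. *)
Definition borel_poset (R : realType) {d : Order.disp_t}
    (P : POrderedTopological.type d) : Prop :=
  polish R P /\ borel [set p : P * P | (p.1 <= p.2)%O].

Section chain_conditions.
Context {d : Order.disp_t} {P : POrderedTopological.type d}.
Implicit Types (A B : set P) (n : nat).

Definition n_linked n A : Prop :=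
  forall B, B `<=` A -> B #= `I_n -> lbound B !=set0.

Definition linked A : Prop := n_linked 2 A.

Definition centred A : Prop := forall n, 1 < n -> n_linked n A.

Definition compatible (x y : P) : Prop := linked [set x; y].

Definition antichain A : Prop :=
  forall x y, A x -> A y -> x <> y -> ~ compatible x y.

End chain_conditions.

Section borel_sigma.
Context {d : Order.disp_t} (P : POrderedTopological.type d).

Definition borel_sigma_finite_cc : Prop :=
  exists F : nat -> set P,
    [/\ \bigcup_k F k = setT, (forall k, borel (F k)) &
        forall k B, B `<=` F k -> antichain B -> ~ infinite_set B].

(* The pieces are indexed from 1: the empty set is an antichain of size 0, so
   no piece could satisfy the condition for n = 0. *)
Definition borel_sigma_bounded_cc : Prop :=
  exists F : nat -> set P,
    [/\ \bigcup_(n in [set n | 0 < n]) F n = setT,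
        (forall n, 0 < n -> borel (F n)) &
        forall n, 0 < n ->
          forall B, B `<=` F n -> antichain B -> ~ (`I_n #<= B)].

Definition borel_sigma_n_linked (n : nat) : Prop :=
  exists F : nat -> set P,
    [/\ \bigcup_k F k = setT, (forall k, borel (F k)) &
        forall k, n_linked n (F k)].

Definition borel_sigma_centred : Prop :=
  exists F : nat -> set P,
    [/\ \bigcup_k F k = setT, (forall k, borel (F k)) &
        forall k, centred (F k)].

End borel_sigma.

(* Main.v *)
(* Fix a hypergraph on the space of words nat -> nat, each edge of which
   consists of words differing from each other in one coordinate d only, the
   direction of the edge. The conditions are the finite sets of words containing
   no edge, ordered by reverse inclusion, so that compatibility of finitely many
   conditions means that their union contains no edge.

   On a comeager set, membership in a given Borel set is decided by finitely
   many coordinates. So, for every cover of the poset by countably many Borel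
   sets, one of them contains, in every large enough direction, all one-point
   conditions of some line; an edge in that line is a set of conditions with no
   common lower bound.

   Conversely, each condition has a length m separating its points and a longer
   one deciding which of them agree from m on. Two conditions with the same such
   data form a union whose edges have direction at least m and so meet each
   condition in at most one point: the conditions with given data are n-linked
   when all edges in directions at least m have more than n points. When the
   edges are pairs, an edge joins points with the same head, of which there are
   finitely many. An infinite antichain is then excluded by an ultrafilter,
   cliques being finite; when all values in edges are 0 or 1, the parities of the
   points bound the size of an antichain.

   The examples are: the pairs of values below d + 2 in direction d for (1), the
   pair {0, 1} for (2), the full line {0, ..., n - 1} for (3), and the full line
   {0, ..., d + 1} in direction d for (4). *)
From HB Require Import structures.
Require Import Defs.
From mathcomp Require Import all_boot all_order all_algebra.
From mathcomp Require Import all_classical all_reals all_analysis.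

Set Implicit Arguments.
Unset Strict Implicit.
Unset Printing Implicit Defensive.

Import Order.TTheory GRing.Theory Num.Theory.

Local Open Scope classical_set_scope.
Local Open Scope card_scope.


(** * The space of codes *)

(** The sets [[set q | agree n p q]] form a base of clopen neighbourhoods of [p] in the product
    topology. *)
Definition agree (n : nat) (p q : nat -> nat -> nat) : Prop :=
  forall i j, i < n -> j < n -> p i j = q i j.

Lemma agree_refl n p : agree n p p. Proof. by []. Qed.

Lemma agree_sym n p q : agree n p q -> agree n q p.
Proof. by move=> pq i j ? ?; rewrite pq. Qed.

Lemma agree_trans n p q r : agree n p q -> agree n q r -> agree n p r.
Proof. by move=> pq qr i j ? ?; rewrite pq// qr. Qed.

Lemma agree_le m n p q : m <= n -> agree n p q -> agree m p q.
Proof. by move=> mn pq i j im jm; apply: pq; exact: leq_trans mn. Qed.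

Lemma agree_eq p q : (forall n, agree n p q) -> p = q.
Proof.
move=> pq; apply/funext => i; apply/funext => j.
by apply: (pq (maxn i j).+1); rewrite ltnS ?leq_maxl ?leq_maxr.
Qed.

Section ultrametric.
Context {R : realType}.
Local Open Scope ring_scope.

(** [ex_minn h] is the size of the least square on which the arrays differ. It is positive, since
    squares of size 0 always agree. *)
Definition agree_dist (p q : nat -> nat -> nat) : R :=
  if pselect (exists n, `[< ~ agree n p q >]) is left h
  then (ex_minn h)%:R^-1 else 0.

Lemma agree_dist_ge0 p q : 0 <= agree_dist p q.
Proof.
by rewrite /agree_dist; case: pselect => // h; rewrite invr_ge0.
Qed.

Lemma agree_dist_lt n p q : (0 < n)%N ->
  agree_dist p q < n%:R^-1 <-> agree n p q.
Proof.
move=> n0; rewrite /agree_dist; case: pselect => [h|h].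
  case: ex_minnP => m /asboolP mpq mmin.
  have m0 : (0 < m)%N by case: (posnP m) mpq => [->|//] [].
  rewrite ltf_pV2 ?posrE ?ltr0n// ltr_nat; split=> [nm|npq].
    apply: contrapT => npq; have /mmin : `[< ~ agree n p q >] by exact/asboolP.
    by rewrite leqNgt nm.
  by rewrite ltnNge; apply/negP => mn; exact/mpq/(agree_le mn).
rewrite invr_gt0 ltr0n; split=> // _; apply: contrapT => npq; apply: h.
by exists n; exact/asboolP.
Qed.

Lemma agree_dist_sym p q : agree_dist p q = agree_dist q p.
Proof.
suff h x y : agree_dist x y <= agree_dist y x by apply/eqP; rewrite eq_le !h.
rewrite {2}/agree_dist; case: pselect => [h|h].
  case: ex_minnP => m /asboolP mpq mmin.
  rewrite /agree_dist; case: pselect => [h'|h']; last by rewrite invr_ge0.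
  case: ex_minnP => m' /asboolP mpq' _.
  have m0 : (0 < m)%N by case: (posnP m) mpq => [->|//] [].
  have m0' : (0 < m')%N by case: (posnP m') mpq' => [->|//] [].
  rewrite lef_pV2 ?posrE ?ltr0n// ler_nat; apply: mmin.
  by apply/asboolP => yx; apply: mpq'; exact: agree_sym.
rewrite /agree_dist; case: pselect => // h'.
have [m /asboolP mxy] := h'; exfalso; apply: h.
by exists m; apply/asboolP => yx; apply: mxy; exact: agree_sym.
Qed.

Lemma agree_dist_max p q r :
  agree_dist p r <= Num.max (agree_dist p q) (agree_dist q r).
Proof.
rewrite {1}/agree_dist; case: pselect => [h|h]; last first.
  by rewrite le_max agree_dist_ge0.
case: ex_minnP => m /asboolP mpr _; rewrite leNgt gt_max; apply/negP => /andP[].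
have m0 : (0 < m)%N by case: (posnP m) mpr => [->|//] [].
by move=> /(agree_dist_lt _ _ m0) ? /(agree_dist_lt _ _ m0) /(agree_trans _)/mpr.
Qed.

Lemma agree_dist_triangle q p r :
  agree_dist p r <= agree_dist p q + agree_dist q r.
Proof.
rewrite (le_trans (agree_dist_max p q r))// ge_max.
by rewrite lerDl lerDr !agree_dist_ge0.
Qed.

Lemma agree_distxx p : agree_dist p p = 0.
Proof. by rewrite /agree_dist; case: pselect => // -[n /asboolP[]]. Qed.

Lemma agree_dist_eq0 p q : agree_dist p q = 0 -> p = q.
Proof.
move=> pq0; apply: agree_eq => -[//|n].
by apply/(@agree_dist_lt n.+1); rewrite ?pq0 ?invr_gt0.
Qed.

End ultrametric.

(** The parameters tag one carrier, the Baire space of arrays: the metric takes its values in [R],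
    and the order depends on [E]. *)
Definition cond (R : realType) (E : nat -> set (seq nat)) : Type :=
  nat -> nat -> nat.

Section cond_topology.
Context (R : realType) (E : nat -> set (seq nat)).

HB.instance Definition _ := gen_eqMixin (cond R E).
HB.instance Definition _ := gen_choiceMixin (cond R E).
HB.instance Definition _ := @isMetric.Build R (cond R E) (@agree_dist R)
  agree_distxx agree_dist_eq0 agree_dist_sym agree_dist_triangle.

End cond_topology.

Section cond_polish.
Context {R : realType} {E : nat -> set (seq nat)}.
Local Notation cond := (cond R E).
Implicit Types (p q : cond) (A : set cond).

Lemma nbhs_condP p A : nbhs p A <-> exists n, [set q | agree n p q] `<=` A.
Proof.
split=> [/nbhs_ballP[e /= e0 peA]|[n nA]].
  have := e0; rewrite -invr_gt0 => ei0; pose n := (Num.truncn e^-1).+1.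
  exists n => q npq; apply: peA; rewrite ballEmdist/=.
  have /(@agree_dist_lt R n p q isT) : agree n p q by [].
  move=> /lt_trans; apply.
  by rewrite -[ltRHS]invrK ltf_pV2 ?posrE ?ltr0n// truncnS_gt.
apply/nbhs_ballP; exists (n.+1%:R^-1)%R => /=; first by rewrite invr_gt0 ltr0n.
move=> q; rewrite ballEmdist /= => /(agree_dist_lt _ _ (ltn0Sn n)) npq.
exact/nA/(agree_le (leqnSn n)).
Qed.

Lemma open_condP A :
  open A <-> forall p, A p -> exists n, [set q | agree n p q] `<=` A.
Proof.
rewrite openE; split=> [oA p /oA/nbhs_condP//|nA p Ap].
exact/nbhs_condP/nA.
Qed.

Lemma open_agree n p : open [set q : cond | agree n p q].
Proof. by apply/open_condP => q npq; exists n => r; exact: agree_trans. Qed.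

Lemma open_coord i j c : open [set p : cond | p i j = c].
Proof.
apply/open_condP => p <-; exists (maxn i j).+1 => q /= pq.
by apply/esym/pq; rewrite ltnS ?leq_maxl ?leq_maxr.
Qed.

(** Arrays with finitely many nonzero entries, coded by lists so as to be countably many. *)
Definition rational (t : seq (seq nat)) : cond :=
  fun i j => nth 0 (nth [::] t i) j.

Lemma agree_rational n p : exists t, agree n p (rational t).
Proof.
exists [seq [seq p i j | j <- iota 0 n] | i <- iota 0 n] => i j iln jln.
rewrite /rational (nth_map 0) ?size_iota// (nth_map 0) ?size_iota//.
by rewrite !nth_iota.
Qed.

Lemma separable_cond : separable cond.
Proof.
exists (range rational);
  first exact: card_le_trans (card_image_le _ _) (countableP _).
move=> O [p Op] /open_condP/(_ _ Op)[n nO].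
by have [t pt] := agree_rational n p; exists (rational t); split=> //; exact: nO.
Qed.

Lemma complete_cond : complete_space cond.
Proof.
move=> F FF /cauchyP Fc.
have Fn n : exists x : cond, F [set q | agree n x q].
  have [|x] := Fc (n.+1%:R^-1)%R; first by rewrite invr_gt0 ltr0n.
  rewrite ballEmdist => Fx; exists x; apply: filterS Fx => q /=.
  move=> /(agree_dist_lt _ _ (ltn0Sn n)).
  exact: (agree_le (leqnSn n)).
have [x_ Fx] := choice Fn.
(* Entry (i, j) of the limit is read off an approximation that is correct on a square containing
   that entry. *)
pose l : cond := fun i j => x_ (maxn i j).+1 i j.
exists l => A /nbhs_condP[n nA]; rewrite /nbhs /=.
apply: (filterS nA); apply: filterS (Fx n) => q /= xq i j iln jln.
set m := (maxn i j).+1.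
have [r [nr mr]] := @filter_ex _ F _ _ (filterI (Fx n) (Fx m)).
by rewrite /l mr ?ltnS ?leq_maxl ?leq_maxr// -nr// xq.
Qed.

Lemma polish_cond : polish R cond.
Proof.
split; first exact: separable_cond.
exists cond, id, id; split=> //; [by move=> ? | by move=> ? | exact: complete_cond].
Qed.

End cond_polish.

(** * Borel sets *)

Section borel_formulas.
Context {T : topologicalType}.
Implicit Types (P Q : T -> Prop) (I : countType).

Lemma borel_open (A : set T) : open A -> borel A.
Proof. by move=> oA; exact: sub_gen_smallest. Qed.

Lemma borel_not P : borel [set x | P x] -> borel [set x | ~ P x].
Proof. by move=> /sigma_algebraCD; rewrite setTD. Qed.

Lemma borel_ex I (P : I -> T -> Prop) :
  (forall i, borel [set x | P i x]) -> borel [set x | exists i, P i x].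
Proof.
move=> bP; pose F n : set T := if unpickle n is Some i then P i else set0.
have -> : [set x | exists i, P i x] = \bigcup_n F n.
  apply/seteqP; split=> x /=.
    by move=> [i Pix]; exists (pickle i) => //; rewrite /F pickleK.
  by move=> [n _]; rewrite /F; case: unpickle => // i; exists i.
apply: sigma_algebra_bigcup => n; rewrite /F; case: unpickle => [i|].
  exact: bP.
exact: sigma_algebra0.
Qed.

Lemma borel_all I (P : I -> T -> Prop) :
  (forall i, borel [set x | P i x]) -> borel [set x | forall i, P i x].
Proof.
move=> bP.
have -> : [set x | forall i, P i x] = [set x | ~ exists i, ~ P i x].
  by apply/seteqP; split=> x /=; rewrite -forallNP => h i;
    [move=> /(_ (h i)) | exact: contrapT].
by apply: borel_not; apply: borel_ex => i; exact: borel_not.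
Qed.

Lemma borel_and P Q : borel [set x | P x] -> borel [set x | Q x] ->
  borel [set x | P x /\ Q x].
Proof.
move=> bP bQ; have -> : [set x | P x /\ Q x] =
    [set x | forall b : bool, (if b then P else Q) x].
  apply/seteqP; split=> x /=; first by move=> [Px Qx]; case.
  by move=> h; move: (h true) (h false).
by apply: borel_all => -[].
Qed.

Lemma borel_or P Q : borel [set x | P x] -> borel [set x | Q x] ->
  borel [set x | P x \/ Q x].
Proof.
move=> bP bQ; have -> : [set x | P x \/ Q x] =
    [set x | exists b : bool, (if b then P else Q) x].
  apply/seteqP; split=> x /=.
    by move=> [Px|Qx]; [exists true|exists false].
  by move=> [[]]; [left|right].
by apply: borel_ex => -[].
Qed.

Lemma borel_imp P Q : borel [set x | P x] -> borel [set x | Q x] ->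
  borel [set x | P x -> Q x].
Proof.
move=> bP bQ; have -> : [set x | P x -> Q x] = [set x | ~ P x \/ Q x].
  by apply/funext => x; rewrite /mkset implyE.
by apply: borel_or => //; exact: borel_not.
Qed.

Lemma borel_const (X : Prop) : borel [set _ : T | X].
Proof.
have [x|nx] := pselect X; [apply: borel_open|apply: borel_open].
- by rewrite (_ : mkset _ = setT); [exact: openT|by apply/seteqP; split].
- by rewrite (_ : mkset _ = set0); [exact: open0|by apply/seteqP; split].
Qed.

(** Borel measurability of a map into the discrete space [nat], tested on fibres. *)
Definition coordinate (f : T -> nat) := forall c, borel [set x | f x = c].

Lemma borel_coord2 (Q : nat -> nat -> Prop) f g : coordinate f ->
  coordinate g -> borel [set x | Q (f x) (g x)].
Proof.
move=> bf bg; have -> : [set x | Q (f x) (g x)] =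
    [set x | exists c, exists c', (f x = c /\ g x = c') /\ Q c c'].
  apply/seteqP; split=> x /=; last by move=> [c [c' [[<- <-]]]].
  by move=> Qx; exists (f x), (g x).
apply: borel_ex => c; apply: borel_ex => c'.
apply: borel_and; last exact: borel_const.
exact: borel_and.
Qed.

End borel_formulas.

(** * The poset *)

Definition word := nat -> nat.

Definition upd (x : word) (d a : nat) : word :=
  fun e => if e == d then a else x e.

(* [E d A] makes {upd x d a | a in A} an edge for every word x. *)
Definition independent (E : nat -> set (seq nat)) (S : set word) : Prop :=
  forall d A x, E d A -> ~ (forall a, a \in A -> S (upd x d a)).

Definition edge_family (E : nat -> set (seq nat)) : Prop :=
  forall d A, E d A -> uniq A /\ 1 < size A.

Section cond_order.
Context {R : realType} {E : nat -> set (seq nat)}.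
Implicit Types p q r : cond R E.

(* A condition codes the finite set of points listed by its rows 1, ..., p 0 0;
   p 0 1 is a level, there only to make the order antisymmetric. *)
Definition pts p : set word := [set x | exists2 i, i < p 0 0 & x = p i.+1].

(* Codes of dependent sets are not excluded: they stand for the empty set. *)
Definition supp p : set word := [set x | independent E (pts p) /\ pts p x].

Definition level p : nat := p 0 1.

(** Having a point in the support already forces [pts p] to be independent, and an edge is never
    empty. *)
Lemma independent_supp p : edge_family E -> independent E (supp p).
Proof.
move=> Ee d A x EA Ap; have [_ A1] := Ee _ _ EA.
case: A A1 EA Ap => // a A _ EA Ap; have [ip _] := Ap a (mem_head _ _).
by apply: (ip d (a :: A) x EA) => b /Ap[].
Qed.

Lemma finite_pts p : finite_set (pts p).
Proof.
rewrite (_ : pts p = (fun i => p i.+1) @` `I_(p 0 0)).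
  exact/finite_image/finite_II.
by apply/seteqP; split=> x [i ip xE]; exists i.
Qed.

Lemma finite_supp p : finite_set (supp p).
Proof. by apply: sub_finite_set (finite_pts p) => x []. Qed.

(** Two distinct codes of the same set at the same level are incomparable, yet both lie above every
    code of that set at a higher level. *)
Definition cond_lt p q := `[< supp q `<=` supp p /\ level q < level p >].

Lemma cond_lt_irr : irreflexive cond_lt.
Proof. by move=> p; apply/asboolP => -[_]; rewrite ltnn. Qed.

Lemma cond_lt_trans : transitive cond_lt.
Proof.
move=> q p r /asboolP[pq lpq] /asboolP[qr lqr]; apply/asboolP; split.
  exact: subset_trans pq.
exact: ltn_trans lpq.
Qed.

End cond_order.

HB.instance Definition _ (R : realType) (E : nat -> set (seq nat)) :=
  Order.Lt_isPOrder.Build (Order.default_display) (cond R E) (@cond_lt_irr R E)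
    (@cond_lt_trans R E).

Lemma updK x d a b : upd (upd x d a) d b = upd x d b.
Proof. by apply/funext => e; rewrite /upd; case: eqP. Qed.

Lemma upd_eq x d : upd x d (x d) = x.
Proof. by apply/funext => e; rewrite /upd; case: eqP => // ->. Qed.

Section cond_theory.
Context {R : realType} {E : nat -> set (seq nat)}.
Implicit Types (p q r : cond R E) (B : set (cond R E)).

Lemma le_condP p q :
  (p <= q)%O <-> p = q \/ supp q `<=` supp p /\ level q < level p.
Proof.
rewrite le_eqVlt; split=> [/orP[/eqP|/asboolP]|[->|pq]]; [by left|by right| |].
  by rewrite eqxx.
by apply/orP; right; exact/asboolP.
Qed.

Lemma le_supp p q : (p <= q)%O -> supp q `<=` supp p.
Proof. by move=> /le_condP[->|[]]. Qed.

Lemma lbound_supp B r : lbound B r -> \bigcup_(p in B) supp p `<=` supp r.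
Proof. by move=> rB x [p /rB/le_supp pr] /pr. Qed.

Definition cond_of (s : seq word) (l : nat) : cond R E := fun i =>
  if i is i'.+1 then nth (fun=> 0) s i'
  else fun j => if j == 0 then size s else l.

Lemma pts_cond_of s l : pts (cond_of s l) = [set` s].
Proof.
apply/seteqP; split=> x /=; first by move=> [i /= ilt ->]; exact: mem_nth.
by move=> xs; exists (index x s); rewrite /= ?index_mem// nth_index.
Qed.

Lemma supp_cond_of s l : independent E [set` s] ->
  supp (cond_of s l) = [set` s].
Proof.
by move=> si; rewrite /supp pts_cond_of; apply/seteqP; split=> x //= [].
Qed.

(** The bound codes the union of the supports, at a level exceeding all levels in [B]. *)
Lemma exists_lbound B : finite_set B ->
  independent E (\bigcup_(p in B) supp p) -> lbound B !=set0.
Proof.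
move=> finB iB; have /finite_seqP[s sE] : finite_set (\bigcup_(p in B) supp p).
  by apply: bigcup_finite => // p _; exact: finite_supp.
rewrite sE in iB; have /finite_seqP[t tE] := finB.
exists (cond_of s (\max_(p <- t) level p).+1) => p Bp; apply/le_condP; right.
rewrite supp_cond_of// -sE; split; first exact: bigcup_sup.
by rewrite ltnS; apply: leq_bigmax_seq => //; move: Bp; rewrite tE.
Qed.

(** The base word of an edge may be taken among the rows of [p], which replaces a quantifier over
    all words by a countable one. *)
Lemma independent_ptsP p : edge_family E ->
  independent E (pts p) <-> forall d A j, E d A -> j < p 0 0 ->
    ~ (forall a, a \in A -> pts p (upd (p j.+1) d a)).
Proof.
move=> Ee; split=> [ip d A j EA _|ip d A x EA Ap]; first exact: ip.
have [_] := Ee _ _ EA; case: A EA Ap => // a A EA Ap _.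
have [j jp xj] := Ap a (mem_head _ _).
by apply: (ip d _ j EA jp) => b /Ap; rewrite -xj updK.
Qed.

End cond_theory.

(** * Borelness of the order *)

Section borel_order.
Context {R : realType} {E : nat -> set (seq nat)} {T : topologicalType}.
Hypothesis Ee : edge_family E.
Implicit Types (f g : T -> cond R E) (y : T -> word).

(** Measurability of maps into words and conditions, checked entry by entry. The source [T] will be
    the poset or its square. *)
Definition point_coords y := forall e, coordinate (fun t => y t e).
Definition cond_coords f := forall i, point_coords (fun t => f t i).

Lemma coords_upd y d a : point_coords y -> point_coords (fun t => upd (y t) d a).
Proof.
by move=> yc e c; rewrite /upd; case: (e == d); [exact: borel_const|exact: yc].
Qed.

Lemma borel_ltn i f : cond_coords f -> borel [set t | i < f t 0 0].
Proof.
move=> fc.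
exact: (@borel_coord2 _ (fun m _ => i < m) _ _ (fc 0 0) (fc 0 0)).
Qed.

Lemma borel_point_eq y z : point_coords y -> point_coords z ->
  borel [set t | y t = z t].
Proof.
move=> yc zc; rewrite (_ : mkset _ = [set t | forall e, y t e = z t e]).
  apply: borel_all => e.
  exact: (@borel_coord2 _ (fun m n => m = n) _ _ (yc e) (zc e)).
by apply/seteqP; split=> t /= => [->//|?]; exact/funext.
Qed.

Lemma borel_pts f y : cond_coords f -> point_coords y ->
  borel [set t | pts (f t) (y t)].
Proof.
move=> fc yc; rewrite (_ : mkset _ =
    [set t | exists i, i < f t 0 0 /\ y t = f t i.+1]).
  apply: borel_ex => i; apply: borel_and; first exact: borel_ltn.
  exact: borel_point_eq.
by apply/seteqP; split=> t /= [i]; [exists i|move=> []; exists i].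
Qed.

Lemma borel_independent f : cond_coords f ->
  borel [set t | independent E (pts (f t))].
Proof.
move=> fc; rewrite (_ : mkset _ = [set t | forall d A j, E d A ->
    j < f t 0 0 -> ~ (forall a, a \in A -> pts (f t) (upd (f t j.+1) d a))]).
  apply: borel_all => d; apply: borel_all => A; apply: borel_all => j.
  apply: borel_imp; first exact: borel_const.
  apply: borel_imp; first exact: borel_ltn.
  apply: borel_not; apply: borel_all => a.
  apply: borel_imp; first exact: borel_const.
  by apply: borel_pts => //; exact: coords_upd.
by apply/seteqP; split=> t /= /independent_ptsP; exact.
Qed.

Lemma borel_supp f y : cond_coords f -> point_coords y ->
  borel [set t | supp (f t) (y t)].
Proof.
move=> fc yc; apply: borel_and; first exact: borel_independent.
exact: borel_pts.
Qed.

(* Quantifiers over the support are countable, being over row indices. *)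
Lemma borel_all_supp f (Q : T -> word -> Prop) : cond_coords f ->
  (forall i, borel [set t | Q t (f t i.+1)]) ->
  borel [set t | forall x, supp (f t) x -> Q t x].
Proof.
move=> fc Qf; rewrite (_ : mkset _ =
    [set t | forall i, supp (f t) (f t i.+1) -> Q t (f t i.+1)]).
  by apply: borel_all => i; apply: borel_imp => //; exact: borel_supp.
apply/seteqP; split=> t /= h; first by move=> i; exact: h.
by move=> _ [ip [i ilt ->]]; apply: h; split => //; exists i.
Qed.

Lemma borel_ex_supp f (Q : T -> word -> Prop) : cond_coords f ->
  (forall i, borel [set t | Q t (f t i.+1)]) ->
  borel [set t | exists2 x, supp (f t) x & Q t x].
Proof.
move=> fc Qf; rewrite (_ : mkset _ =
    [set t | ~ (forall x, supp (f t) x -> ~ Q t x)]).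
  by apply: borel_not; apply: borel_all_supp => // i; exact: borel_not.
apply/seteqP; split=> t /=; first by move=> [x fx Qx] /(_ _ fx).
by move=> /existsNP[x /not_implyP[fx /contrapT]]; exists x.
Qed.

Lemma borel_le f g : cond_coords f -> cond_coords g ->
  borel [set t | (f t <= g t)%O].
Proof.
move=> fc gc; rewrite (_ : mkset _ = [set t | (forall i, f t i = g t i) \/
    (forall x, supp (g t) x -> supp (f t) x) /\ level (g t) < level (f t)]).
  apply: borel_or; first by apply: borel_all => i; exact: borel_point_eq.
  apply: borel_and; last first.
    exact: (@borel_coord2 _ (fun m n => m < n) _ _ (gc 0 1) (fc 0 1)).
  by apply: borel_all_supp => // i; exact: borel_supp.
apply/seteqP; split=> t /=.
  by move=> /le_condP[->|[]]; [left|right].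
by move=> h; apply/le_condP; case: h => [/funext|]; [left|right].
Qed.

End borel_order.

Lemma borel_poset_cond (R : realType) (E : nat -> set (seq nat)) :
  edge_family E -> borel_poset R (cond R E).
Proof.
move=> Ee; split; first exact: polish_cond.
apply: borel_le => // i j c; apply: borel_open.
  apply: (@open_comp _ _ fst [set p : cond R E | p i j = c]) => [? _|].
    exact: cvg_fst.
  exact: open_coord.
apply: (@open_comp _ _ snd [set p : cond R E | p i j = c]) => [? _|].
  exact: cvg_snd.
exact: open_coord.
Qed.

(** * Baire category *)

Definition comeager {T : topologicalType} (G : set T) : Prop :=
  exists U : nat -> set T,
    (forall i, open (U i) /\ dense (U i)) /\ \bigcap_i U i `<=` G.

Lemma sub_comeager (T : topologicalType) (G H : set T) :
  G `<=` H -> comeager G -> comeager H.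
Proof.
by move=> GH [U [Uod UG]]; exists U; split=> //; exact: subset_trans GH.
Qed.

Lemma open_dense_comeager (T : topologicalType) (U : set T) :
  open U -> dense U -> comeager U.
Proof. by move=> oU dU; exists (fun=> U); split=> // x; exact: (fun h => h 0 I). Qed.

Lemma comeagerT (T : topologicalType) : comeager [set: T].
Proof.
apply: open_dense_comeager; first exact: openT.
by move=> O O0 _; rewrite setIT.
Qed.

Lemma comeager_all (T : topologicalType) (J : countType) (G : J -> set T) :
  (forall i, comeager (G i)) -> comeager [set x | forall i, G i x].
Proof.
move=> /choice[U UG]; pose V n := if unpickle n is Some ij then
  U ij.1 ij.2 : set T else setT.
exists V; split=> [n|x Vx i].
  rewrite /V; case: unpickle => [[i j]|]; first by have [+ _] := UG i; exact.
  by split; [exact: openT|move=> O O0 _; rewrite setIT].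
have [_] := UG i; apply => j _.
by have := Vx (pickle (i, j)) I; rewrite /V pickleK.
Qed.

Lemma comeagerI (T : topologicalType) (G H : set T) :
  comeager G -> comeager H -> comeager (G `&` H).
Proof.
move=> cG cH; apply: (@sub_comeager _ [set x | forall b, (if b then G else H) x]).
  by move=> x GHx; split; [exact: (GHx true)|exact: (GHx false)].
by apply: comeager_all => -[].
Qed.

Section baire.
Context {R : realType} {E : nat -> set (seq nat)}.
Local Notation cond := (cond R E).
Implicit Types (p q : cond) (G W A : set cond).

Lemma dense_condP A :
  (forall p n, exists2 q, agree n p q & A q) -> dense A.
Proof.
move=> dA O [p Op] /open_condP/(_ p Op)[n nO].
by have [q pq Aq] := dA p n; exists q; split=> //; exact: nO.
Qed.

(** Baire category theorem: nested basic neighbourhoods are chosen, each inside the next dense open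
    set. Their squares grow strictly, so that they determine every entry of a limit. *)
Lemma baire_cond G p n : comeager G -> exists2 q, agree n p q & G q.
Proof.
move=> [U [oU UG]].
have step i (s : cond * nat) : exists s' : cond * nat, [/\ s.2 < s'.2,
    agree s.2 s.1 s'.1 & [set q | agree s'.2 s'.1 q] `<=` U i].
  have [/open_condP Uo Ud] := oU i.
  have [|q [/= pq Uq]] := Ud _ _ (@open_agree R E s.2 s.1); first by exists s.1.
  have [m mU] := Uo q Uq; exists (q, maxn m s.2.+1) => /=; split=> //.
    by rewrite leq_max ltnSn orbT.
  by move=> r /(agree_le (leq_maxl _ _))/mU.
have /choice[next nextP] : forall i, exists f : cond * nat -> cond * nat,
    forall s, [/\ s.2 < (f s).2, agree s.2 s.1 (f s).1 &
      [set q | agree (f s).2 (f s).1 q] `<=` U i].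
  by move=> i; have /choice[f] := step i; exists f.
pose s := fix s k := if k is k'.+1 then next k' (s k') else (p, n).
have sP k : [/\ (s k).2 < (s k.+1).2, agree (s k).2 (s k).1 (s k.+1).1 &
    [set q | agree (s k.+1).2 (s k.+1).1 q] `<=` U k] by exact: nextP.
have s_ge k : k <= (s k).2.
  by elim: k => // k IHk; have [+ _ _] := sP k; exact: leq_ltn_trans.
have s_le k m : (s k).2 <= (s (k + m)).2.
  elim: m => [|m IHm]; first by rewrite addn0.
  by rewrite addnS (leq_trans IHm)//; have [/ltnW] := sP (k + m).
have s_agree k m : agree (s k).2 (s k).1 (s (k + m)).1.
  elim: m => [|m IHm]; first by rewrite addn0.
  apply: agree_trans IHm _; rewrite addnS; have [_ + _] := sP (k + m).
  exact: (agree_le (s_le _ _)).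
pose l : cond := fun i j => (s (maxn i j).+1).1 i j.
have s_lim k : agree (s k).2 (s k).1 l.
  move=> i j ik jk; rewrite /l; set m := (maxn i j).+1.
  rewrite (s_agree k m)// addnC (s_agree m k)//;
    by rewrite (leq_trans _ (s_ge m))// ltnS ?leq_maxl ?leq_maxr.
exists l; first exact: (s_lim 0).
by apply: UG => k _; have [_ _] := sP k; apply; exact: s_lim.
Qed.

(** What is left out is the boundary of an open set, which is nowhere dense. *)
Lemma comeager_boundary W : open W ->
  comeager (W `|` [set p | exists n, forall q, agree n p q -> ~ W q]).
Proof.
move=> oW; apply: open_dense_comeager.
  apply: openU => //; apply/open_condP => p [n nW]; exists n => q pq.
  by exists n => r qr; apply: nW; exact: agree_trans qr.
apply: dense_condP => p n.
have [[q pq Wq]|nW] := pselect (exists2 q, agree n p q & W q).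
  by exists q => //; left.
exists p => //; right; exists n => q pq Wq; apply: nW.
by exists q.
Qed.

(** A form of the Baire property: a Borel set is relatively clopen on some comeager set. The proof
    is by induction on the generation of the sigma-algebra. *)
Lemma borel_clopen_comeager A : borel A -> exists G, comeager G /\
  forall p, G p -> exists n, forall q, G q -> agree n p q -> (A p <-> A q).
Proof.
move: A; apply: smallest_sub => [|A oA]; last first.
  eexists; split; first exact: comeager_boundary oA.
  move=> p [Ap|[n nA]].
    have /open_condP/(_ p Ap)[n nA] := oA.
    by exists n => q _ /nA.
  by exists n => q _ pq; split=> [/(nA p (@agree_refl _ _))|/(nA q pq)].
split.
- by exists setT; split; [exact: comeagerT|move=> p _; exists 0].
- move=> A [G [cG GA]]; exists G; split=> // p /GA[n nA].
  by exists n => q Gq /(nA q Gq) pq; rewrite setTD; split=> nAp /pq.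
move=> A /choice[G GA].
pose H : set cond := [set p | forall k, G k p].
(* [W] is open and has the same trace on [H] as the union. Leaving out the boundary of [W] makes
   this trace relatively clopen. *)
pose W : set cond :=
  [set p | exists n k, forall q, H q -> agree n p q -> A k q].
have oW : open W.
  apply/open_condP => p [n [k nkA]]; exists n => q pq; exists n, k => r Hr qr.
  by apply: nkA => //; exact: agree_trans qr.
have WA p : H p -> (\bigcup_k A k) p <-> W p.
  move=> Hp; split=> [[k _ Akp]|[n [k nkA]]]; last first.
    by exists k => //; exact: nkA.
  have [_ /(_ p (Hp k))[n nA]] := GA k; exists n, k => q Hq pq.
  by apply/(nA q (Hq k) pq).
exists (H `&` (W `|` [set p | exists n, forall q, agree n p q -> ~ W q])).
split.
  apply: comeagerI; last exact: comeager_boundary.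
  by apply: comeager_all => k; have [] := GA k.
move=> p [Hp [Wp|[n nW]]].
  have /open_condP/(_ p Wp)[n nW] := oW; exists n => q [Hq _] pq.
  by split=> _; apply/WA => //; exact: nW.
exists n => q [Hq _] pq; split=> /WA.
  by move=> /(_ Hp)/(nW p (@agree_refl _ _)).
by move=> /(_ Hq)/(nW q pq).
Qed.

Definition upd1 p d a : cond := fun i => if i == 1 then upd (p 1) d a else p i.

(** The map [upd1] with [d] and [a] fixed is continuous, and preimages of dense open sets under it
    are dense: a point of the image is moved back by restoring one entry. *)
Lemma comeager_upd1 G d a : comeager G -> comeager [set p | G (upd1 p d a)].
Proof.
move=> [U [oU UG]]; exists (fun i => [set p | U i (upd1 p d a)]); split.
  move=> i; have [/open_condP Uo Ud] := oU i; split.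
    apply/open_condP => p /= /Uo[n nU]; exists n => q pq; apply: nU => j e jn en.
    rewrite /upd1; case: eqP => [j1|_]; last exact: pq.
    by rewrite /upd; case: eqP => // _; apply: pq => //; rewrite -j1.
  apply: dense_condP => p n.
  (* The square is large enough to contain entry (1, d), so that [q] has the value [a] there. *)
  have [|q [/= pq Uq]] :=
    Ud _ _ (@open_agree R E (maxn n (maxn d 1).+1) (upd1 p d a)).
    by exists (upd1 p d a).
  exists (upd1 q d (p 1 d)) => [j e jn en|].
    have := pq j e (leq_trans jn (leq_maxl _ _)) (leq_trans en (leq_maxl _ _)).
    rewrite /upd1; case: eqP => [->|//]; rewrite /upd.
    by case: eqP => [->|].
  suff -> : upd1 (upd1 q d (p 1 d)) d a = q by [].
  apply/funext => j; rewrite /upd1 eqxx updK; case: eqP => // ->.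
  rewrite -[RHS](upd_eq _ d); congr (upd _ _ _).
  rewrite -pq.
  - by rewrite /upd1 eqxx /upd eqxx.
  - by rewrite leq_max ltnS leq_maxr orbT.
  - by rewrite leq_max ltnS leq_maxl orbT.
by move=> p Up; apply: UG => i _; exact: (Up i I).
Qed.

(** A generic one-point condition lies in some [F k], and a finite square decides this. Changing the
    point in a direction outside the square cannot leave [F k], as long as the result stays
    generic. *)
Lemma borel_cover_line (F : nat -> set cond) :
  \bigcup_k F k = setT -> (forall k, borel (F k)) ->
  exists k N, forall d, N <= d ->
    exists2 p : cond, p 0 0 = 1 & forall a, F k (upd1 p d a).
Proof.
move=> FT bF; have /choice[G GF] := fun k => borel_clopen_comeager (bF k).
pose H : set cond := [set p | forall k, G k p].
have cH : comeager H by apply: comeager_all => k; have [] := GF k.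
(* Agreement with the constant array 1 on the square of size 1 says that [p] lists exactly one
   point. *)
have [p p1 Hp] := @baire_cond _ (fun _ _ => 1) 1 cH.
have [k _ Fkp] : (\bigcup_k F k) p by rewrite FT.
have [_ /(_ p (Hp k))[n nF]] := GF k.
exists k, (maxn n 1) => d; rewrite geq_max => /andP[nd d0].
(* Near [p] there is a point all of whose countably many variations in direction [d] are generic at
   once. *)
have [] := @baire_cond [set q | forall a, H (upd1 q d a)] p (maxn n 1).
  by apply: comeager_all => a; exact: comeager_upd1.
move=> q pq Hq; exists q => [|a].
  by rewrite -pq ?leq_maxr// -p1.
apply/(nF _ (Hq a k)) => // i j iln jln.
rewrite pq ?leq_max ?iln ?jln// /upd1; case: eqP => [->|//].
by rewrite /upd; case: eqP => // jd; move: jln; rewrite jd ltnNge nd.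
Qed.

End baire.

(** * One-point conditions along a line *)

Section lines.
Context {R : realType} {E : nat -> set (seq nat)}.
Hypothesis Ee : edge_family E.
Local Notation cond := (cond R E).

Lemma independent1 x : independent E [set x].
Proof.
move=> d A y EA; have [+ +] := Ee EA.
case: A EA => [|a [|b A]]//= EA + _ h.
rewrite inE negb_or => /andP[/andP[/eqP ab _] _]; apply: ab.
have := h b; rewrite !inE eqxx orbT -(h a (mem_head _ _)).
move=> /(_ isT)/(congr1 (@^~ d)).
by rewrite /upd eqxx.
Qed.

Lemma supp_upd1 (p : cond) d a : p 0 0 = 1 ->
  supp (upd1 p d a) = [set upd (p 1) d a].
Proof.
move=> p1; have e : pts (upd1 p d a) = [set upd (p 1) d a].
  apply/seteqP; split=> x /=; rewrite /pts /upd1 /= p1.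
    by move=> [[|//] _ ->].
  by move=> ->; exists 0.
rewrite /supp e; apply/seteqP; split=> x /=; first by case.
by move=> ->; split=> //; exact: independent1.
Qed.

Lemma upd1_inj (p : cond) d : injective (upd1 p d).
Proof.
by move=> a b /(congr1 (fun q : cond => q 1 d)); rewrite /upd1 /upd /= eqxx.
Qed.

Lemma line_no_lbound (p : cond) d A (B : set cond) : p 0 0 = 1 -> E d A ->
  (forall a, a \in A -> B (upd1 p d a)) -> ~ (lbound B !=set0).
Proof.
move=> p1 EA AB [r /lbound_supp Br].
apply: (independent_supp (p := r) Ee EA) => a /AB Ba.
by apply: Br; exists (upd1 p d a) => //; rewrite supp_upd1.
Qed.

(** The one-point conditions along an edge [A] are [size A] many, and a common lower bound would
    contain the edge. *)
Lemma borel_cover_not_linked (F : nat -> set cond) :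
  \bigcup_k F k = setT -> (forall k, borel (F k)) ->
  exists k N, forall d A, N <= d -> E d A -> ~ n_linked (size A) (F k).
Proof.
move=> FT bF; have [k [N kN]] := borel_cover_line FT bF.
exists k, N => d A Nd EA Fk; have [p p1 pF] := kN d Nd.
have [uA _] := Ee EA.
pose B : set cond := (fun i => upd1 p d (nth 0 A i)) @` `I_(size A).
have /line_no_lbound : forall a, a \in A -> B (upd1 p d a).
  by move=> a aA; exists (index a A); rewrite /= ?index_mem// nth_index.
move=> /(_ p1 EA); apply.
apply: Fk => [_ [i _ <-]//|]; apply: inj_card_eq => i j.
by rewrite !inE /= => iA jA /upd1_inj/eqP; rewrite nth_uniq// => /eqP.
Qed.

End lines.

(** * Linked pieces *)

Lemma exists_uniform_bound (T : eqType) (s : seq T) (Q : T -> nat -> Prop) n :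
  (forall x m m', m <= m' -> Q x m -> Q x m') ->
  (forall x, x \in s -> exists m, Q x m) ->
  exists2 m, n <= m & forall x, x \in s -> Q x m.
Proof.
move=> Qle; elim: s => [|x s IHs] Qs; first by exists n.
have [|m nm sm] := IHs; first by move=> y ys; apply: Qs; rewrite inE ys orbT.
have [m' xm'] := Qs x (mem_head _ _).
exists (maxn m m'); first by rewrite leq_max nm.
move=> y; rewrite inE => /orP[/eqP->|ys]; first exact: Qle (leq_maxr _ _) xm'.
exact: Qle (leq_maxl _ _) (sm y ys).
Qed.

Definition agree_below (m : nat) (x y : word) := forall e, e < m -> x e = y e.

Definition agree_from (m : nat) (x y : word) := forall e, m <= e -> x e = y e.

Definition agree_between (m n : nat) (x y : word) :=
  forall e, m <= e -> e < n -> x e = y e.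

Lemma agree_below_le m n x y : m <= n -> agree_below n x y -> agree_below m x y.
Proof. by move=> mn xy e em; apply: xy; exact: leq_trans mn. Qed.

Lemma agree_below_from m x y : agree_below m x y -> agree_from m x y -> x = y.
Proof. by move=> xy xy'; apply/funext => e; case: (ltnP e m); auto. Qed.

Lemma agree_upd_below m x d a b : m <= d ->
  agree_below m (upd x d a) (upd x d b).
Proof.
move=> md e em; rewrite /upd; case: eqP => // ed.
by move: em; rewrite ed ltnNge md.
Qed.

Lemma agree_upd_from m x d a b : d < m ->
  agree_from m (upd x d a) (upd x d b).
Proof.
move=> dm e em; rewrite /upd; case: eqP => // ed.
by move: em; rewrite ed leqNgt dm.
Qed.

Section pieces.
Context {R : realType} {E : nat -> set (seq nat)}.
Hypothesis Ee : edge_family E.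
Local Notation cond := (cond R E).
Implicit Types (p q : cond) (B : set cond) (m M n : nat) (S : seq (seq nat)).

(** The head [s] is a finite list, padded with zeros when read as a word, so that there are only
    countably many pieces. *)
Definition headed M (s : seq nat) (x : word) := agree_below M x (nth 0 s).

Lemma headed_agree M s x y : headed M s x -> headed M s y -> agree_below M x y.
Proof. by move=> xs ys e eM; rewrite xs// ys. Qed.

(* The last clause makes the heads decide which points of the support have the
   same tail from m on, so that an edge whose direction is below m cannot be
   spread over several conditions of a piece. *)
Definition piece m M S : set cond := [set p |
  [/\ m <= M,
      forall x, supp p x -> exists s, s \in S /\ headed M s x,
      forall s, s \in S -> exists2 x, supp p x & headed M s x,
      forall x, supp p x -> forall y, supp p y -> agree_below m x y -> x = y &
      forall x, supp p x -> forall y, supp p y ->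
        agree_between m M x y -> agree_from m x y]].

(** Both lengths exist because the support is finite. Taking [m] beyond a given [n] lets early
    directions be ignored. *)
Lemma exists_piece p n : exists m M S, n <= m /\ piece m M S p.
Proof.
have /finite_seqP[s sE] := finite_supp p.
have supp_s x : supp p x <-> x \in s by rewrite sE.
have [||m nm sm] := @exists_uniform_bound _ [seq (x, y) | x <- s, y <- s]
    (fun xy m => agree_below m xy.1 xy.2 -> xy.1 = xy.2) n.
- by move=> xy m m' mm' h h'; apply: h; exact: agree_below_le h'.
- move=> [x y] _ /=; have [->|xy] := eqVneq x y; first by exists 0.
  have [e xye] : exists e, x e <> y e.
    by apply/existsNP => xy'; case/eqP: xy; exact/funext.
  by exists e.+1 => xy'; case: xye; exact: xy'.
have [||M mM sM] := @exists_uniform_bound _ [seq (x, y) | x <- s, y <- s]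
    (fun xy M => agree_between m M xy.1 xy.2 -> agree_from m xy.1 xy.2) m.
- move=> xy M M' MM' h h'; apply: h => e me eM; apply: h' => //.
  exact: leq_trans MM'.
- move=> [x y] _ /=.
  have [xy|/existsNP[e /not_implyP[me xye]]] := pselect (agree_from m x y).
    by exists 0.
  by exists e.+1 => /(_ e me (ltnSn e)).
exists m, M, [seq mkseq x M | x <- s]; split=> //; split=> //.
- move=> x /supp_s xs; exists (mkseq x M); split; first exact: map_f.
  by move=> e eM; rewrite nth_mkseq.
- move=> _ /mapP[x /supp_s xs ->]; exists x => // e eM.
  by rewrite nth_mkseq.
- move=> x /supp_s xs y /supp_s ys; apply: (sm (x, y)).
  exact: allpairs_f.
- move=> x /supp_s xs y /supp_s ys; apply: (sM (x, y)).
  exact: allpairs_f.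
Qed.

Lemma borel_piece m M S : borel (piece m M S).
Proof.
have idc : cond_coords (fun p : cond => p).
  by move=> i j c; apply: borel_open; exact: open_coord.
have eqc i e j f : borel [set p : cond | p i e = p j f].
  exact: (@borel_coord2 _ (fun m n => m = n) _ _ (idc i e) (idc j f)).
have headc i s : borel [set p : cond | headed M s (p i)].
  apply: borel_all => e; apply: borel_imp; first exact: borel_const.
  exact: (@borel_coord2 _ (fun m _ => m = nth 0 s e) _ _ (idc i e) (idc i e)).
rewrite (_ : piece m M S = [set p |
  m <= M /\ (forall x, supp p x -> exists s, s \in S /\ headed M s x) /\
  (forall s, s \in S -> exists2 x, supp p x & headed M s x) /\
  (forall x, supp p x -> forall y, supp p y -> agree_below m x y ->
    forall e, x e = y e) /\
  (forall x, supp p x -> forall y, supp p y ->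
    agree_between m M x y -> agree_from m x y)]).
  apply: borel_and; first exact: borel_const.
  apply: borel_and.
    apply: borel_all_supp => // i; apply: borel_ex => s.
    by apply: borel_and; first exact: borel_const.
  apply: borel_and.
    apply: borel_all => s; apply: borel_imp; first exact: borel_const.
    exact: borel_ex_supp.
  apply: borel_and.
    apply: borel_all_supp => // i; apply: borel_all_supp => // j.
    apply: borel_imp; last exact: borel_all.
    by apply: borel_all => e; apply: borel_imp => //; exact: borel_const.
  apply: borel_all_supp => // i; apply: borel_all_supp => // j.
  apply: borel_imp.
    apply: borel_all => e; apply: borel_imp; first exact: borel_const.
    by apply: borel_imp => //; exact: borel_const.
  by apply: borel_all => e; apply: borel_imp => //; exact: borel_const.
apply/seteqP; split=> p /=.
  move=> [? ? ? h ?]; do !split => //.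
  by move=> x px y py /(h x px y py) ->.
move=> [? [? [? [h ?]]]]; split=> // x px y py /(h x px y py).
by move=> ?; exact/funext.
Qed.

(** Suppose [d < m], and let [p] contain one point of the edge. For any other point of the edge, [p]
    has a point [z] with the same head. Between [m] and [M] this [z] agrees with the point of [p] on
    the edge, hence also from [m] on, so [z] is that other point. Thus [p] would contain the whole
    edge. *)
Lemma piece_edge m M S B d A x : B `<=` piece m M S -> E d A ->
  (forall a, a \in A -> (\bigcup_(p in B) supp p) (upd x d a)) -> m <= d.
Proof.
move=> BS EA AB; have [_ A1] := Ee EA; rewrite leqNgt; apply/negP => dm.
have [a0 a0A] : exists a, a \in A.
  by case: (A) A1 => // a A' _; exists a; exact: mem_head.
have [p Bp pa0] := AB a0 a0A; have [mM _ pS _ pfrom] := BS p Bp.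
apply: (independent_supp (p := p) Ee EA (x := x)) => a aA.
have [q Bq qa] := AB a aA; have [_ qS _ _ _] := BS q Bq.
have [s [sS sa]] := qS _ qa; have [z pz sz] := pS s sS.
have za : agree_below M z (upd x d a) by exact: headed_agree sa.
have za0 : agree_from m z (upd x d a0).
  apply: pfrom => // e me eM; rewrite za//.
  exact: (@agree_upd_from m x d _ _ dm e me).
suff <- : z = upd x d a by [].
apply: (@agree_below_from m); first exact: agree_below_le za.
move=> e me; rewrite za0//; exact: (@agree_upd_from m x d _ _ dm e me).
Qed.

(** The points of an edge in the union agree below [m], so each condition contains at most one of
    them; [n] conditions cannot cover more than [n] points. *)
Lemma piece_linked n m M S : (forall d A, m <= d -> E d A -> n < size A) ->
  n_linked n (piece m M S).
Proof.
move=> nE B BS Bn; apply: exists_lbound; first by apply/finite_setP; exists n.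
move=> d A x EA AB; have md := piece_edge BS EA AB.
have [uA A1] := Ee EA.
have /choice[f fP] : forall i, exists p, i < size A ->
    B p /\ supp p (upd x d (nth 0 A i)).
  move=> i; case: (ltnP i (size A)) => [iA|_]; last by exists (fun _ _ => 0).
  by have [p Bp ?] := AB _ (mem_nth 0 iA); exists p.
have : f @` `I_(size A) #= `I_(size A).
  apply: inj_card_eq => i j; rewrite !inE/= => iA jA fij.
  have [Bf fi] := fP i iA; have [_ fj] := fP j jA; rewrite -fij in fj.
  have [_ _ _ fsep _] := BS _ Bf.
  have /(congr1 (@^~ d)) := fsep _ fi _ fj (@agree_upd_below m x d _ _ md).
  by rewrite /upd eqxx => /eqP; rewrite nth_uniq// => /eqP.
have : f @` `I_(size A) #<= B.
  by apply: subset_card_le => _ [i /fP[? _] <-].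
move=> fB fA; have := nE d A md EA.
rewrite ltnNge -card_le_II => /negP; apply.
by rewrite -(card_le_eql fA) -(card_le_eqr Bn).
Qed.

End pieces.

(** * Graphs *)

Lemma ultra_cover_seq (T : Type) (J : eqType) (U : set_system T) (s : seq J)
    (P : J -> set T) (A : set T) : UltraFilter U -> U A ->
  (forall x, A x -> exists2 i, i \in s & P i x) -> exists2 i, i \in s & U (P i).
Proof.
move=> UU; elim: s A => [|i s IHs] A UA AP.
  by have [x /AP[]] := filter_ex UA.
have [UPi|UPi] := in_ultra_setVsetC (P i) UU.
  by exists i => //; exact: mem_head.
have [x [Ax nPx]|j js UPj] := IHs _ (filterI UA UPi).
  by have [j] := AP x Ax; rewrite inE => /orP[/eqP->//|js Pj]; exists j.
by exists j => //; rewrite inE js orbT.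
Qed.

(** Any ultrafilter extending the filter of sets that contain all but finitely many points of
    [B]. *)
Lemma infinite_ultra (T : Type) (B : set T) : infinite_set B ->
  exists U, [/\ UltraFilter U, U B & forall x, U (B `\ x)].
Proof.
move=> Binf; pose F : set_system T := [set A | finite_set (B `\` A)].
have FF : ProperFilter F.
  split; first by rewrite /F /= setD0.
  split=> [|A C|A C AC]; rewrite /F /=.
  - by rewrite setDT.
  - by rewrite setDIr finite_setU.
  - by apply: sub_finite_set; exact: setDS.
have [U [UU FU]] := ultraFilterLemma FF; exists U; split=> //.
  by apply: FU; rewrite /F /= setDv.
move=> x; apply: FU; rewrite /F /=; apply: (@sub_finite_set _ _ [set x]) => //.
by move=> y [By /= /not_andP[|/contrapT]].
Qed.

(** On each line in direction [d], the complete graph on the points with value below [nu d]. *)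
Definition graph_family (nu : nat -> nat) (d : nat) : set (seq nat) :=
  [set A | exists a b, [/\ A = [:: a; b], a <> b, a < nu d & b < nu d]].

Lemma graph_edge_family nu : edge_family (graph_family nu).
Proof.
move=> d A [a [b [-> /eqP ab _ _]]]; split=> //=.
by rewrite inE ab.
Qed.

Definition adj (nu : nat -> nat) (d : nat) (x y : word) : Prop :=
  [/\ x d <> y d, x d < nu d, y d < nu d & forall e, e <> d -> x e = y e].

Lemma adj_upd nu x d a b : a <> b -> a < nu d -> b < nu d ->
  adj nu d (upd x d a) (upd x d b).
Proof.
move=> ab ad bd; rewrite /adj /upd eqxx; split=> // e ed.
by case: eqP.
Qed.

Lemma adj_upd_eq nu d x y : adj nu d x y -> y = upd x d (y d).
Proof.
move=> [_ _ _ xy]; apply/funext => e; rewrite /upd; case: eqP => [->//|/xy].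
exact: esym.
Qed.

(* Cliques lie in lines. *)
Lemma adj_triangle nu d d1 d2 x y z :
  adj nu d x y -> adj nu d1 x z -> adj nu d2 y z -> d1 = d.
Proof.
move=> [xyd _ _ xy] [xzd1 _ _ xz] [_ _ _ yz].
apply: contrapT => d1d; have yzd : y d <> z d.
  by rewrite -(xz d); exact: nesym.
have dd2 : d2 = d by apply: contrapT => /nesym/yz.
by apply: xzd1; rewrite xy// yz// dd2.
Qed.

Section graph_chains.
Context {R : realType} {nu : nat -> nat}.
Local Notation E := (graph_family nu).
Local Notation cond := (cond R E).
Implicit Types (p q : cond) (B : set cond) (m M : nat) (S : seq (seq nat)).
Let Ee : edge_family E := graph_edge_family (nu := nu).

(** Neither support contains an edge, so an edge in the union goes from one support to the other. *)
Lemma incompatible_adj p q : ~ compatible p q ->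
  exists d x y, [/\ supp p x, supp q y & adj nu d x y].
Proof.
move=> npq; apply: contrapT => nadj; apply: npq => B Bpq B2.
have isym d x y : adj nu d x y -> adj nu d y x.
  by move=> [? ? ? xy]; split=> //; [exact: nesym|move=> e /xy].
apply: exists_lbound; first by apply/finite_setP; exists 2.
move=> d A x EA AB; case: (EA) => a [b [AE ab ad bd]].
have [[p' Bp' p'a] [q' Bq' q'b]] : (\bigcup_(p in B) supp p) (upd x d a) /\
    (\bigcup_(p in B) supp p) (upd x d b).
  by split; apply: AB; rewrite AE !inE eqxx ?orbT.
have same (r : cond) : ~ (supp r (upd x d a) /\ supp r (upd x d b)).
  move=> [ra rb]; apply: (independent_supp (p := r) Ee EA (x := x)) => c.
  by rewrite AE !inE => /orP[]/eqP ->.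
have xab := adj_upd x ab ad bd.
have [p'E|p'E] := Bpq _ Bp'; have [q'E|q'E] := Bpq _ Bq';
  rewrite p'E in p'a; rewrite q'E in q'b.
- exact: (same p).
- by apply: nadj; exists d, (upd x d a), (upd x d b).
- by apply: nadj; exists d, (upd x d b), (upd x d a); split => //; exact: isym.
- exact: (same q).
Qed.

(** [X p s] is the only point of [p] with head [s]. The ends of an edge across two conditions agree
    below [m], and [m] separates the points of each condition, so both ends have the same head.
    Incompatibility is thus witnessed at one of finitely many heads. *)
Lemma piece_adj m M S : exists X : cond -> seq nat -> word, forall p q,
  piece m M S p -> piece m M S q -> ~ compatible p q ->
  exists2 s, s \in S & exists d, adj nu d (X p s) (X q s).
Proof.
have /choice[X XP] : forall p, exists x : seq nat -> word, forall s,
    piece m M S p -> s \in S -> supp p (x s) /\ headed M s (x s).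
  move=> p; suff /choice[x xP] : forall s, exists x, piece m M S p ->
      s \in S -> supp p x /\ headed M s x by exists x => s; exact: xP.
  move=> s; have [[Pp sS]|nP] := pselect (piece m M S p /\ s \in S); last first.
    by exists (fun=> 0) => Pp sS; case: nP.
  by have [_ _ /(_ s sS)[x px xs] _ _] := Pp; exists x.
exists X => p q Pp Pq /incompatible_adj[d [x [y [px qy xy]]]].
have XE r s z : piece m M S r -> s \in S -> supp r z -> headed M s z ->
    X r s = z.
  move=> Pr sS rz sz; have [rX sX] := XP r s Pr sS.
  have [mM _ _ rsep _] := Pr; apply: rsep => //.
  by apply: (agree_below_le mM); exact: headed_agree sz.
have md : m <= d.
  pose B := [set p; q]; have BS : B `<=` piece m M S by move=> r [->|->].
  have xE := adj_upd_eq xy; have [xd xnu ynu _] := xy.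
  apply: (@piece_edge _ _ Ee _ _ _ _ d [:: x d; y d] x BS) => [|a].
    by exists (x d), (y d).
  rewrite !inE => /orP[]/eqP ->; [exists p|exists q] => //.
  - by left.
  - by rewrite upd_eq.
  - by right.
  - by rewrite -xE.
have [mM _ pS psep _] := Pp; have [_ qS _ _ _] := Pq.
have [s [sS sy]] := qS y qy; have [x' px' sx'] := pS s sS.
have x'x : x' = x.
  apply: psep => //; move=> e em.
  rewrite (headed_agree sx' sy) ?(leq_trans em)//; have [_ _ _ xye] := xy.
  by apply/esym/xye => ed; move: em; rewrite ed ltnNge md.
exists s => //; exists d; rewrite (XE p s x)// ?(XE q s y)//.
by rewrite -x'x.
Qed.

Lemma piece_finite_antichain m M S B : B `<=` piece m M S -> antichain B ->
  ~ infinite_set B.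
Proof.
move=> BS Bac Binf; have [X XS] := piece_adj m M S.
have [U [UU UB UD]] := infinite_ultra Binf.
pose N s p := [set q | exists d, adj nu d (X p s) (X q s)].
have BN p : B p -> exists2 s, s \in S & U (N s p).
  move=> Bp; apply: (ultra_cover_seq UU (UD p)) => q [Bq /= qp].
  by apply: XS; [exact: BS|exact: BS|apply: Bac => // pq; exact: qp].
(* A single head [s] now serves almost all [p]: each of these is adjacent at [s] to almost all
   [q]. *)
have [s _ UA] := ultra_cover_seq UU UB BN.
have [p Np] := filter_ex UA; have [q [Nq [d pq]]] := filter_ex (filterI UA Np).
(* Almost every [r] forms a triangle with [p] and [q] at [s], hence lies on their line, where only
   [nu d] values are available. *)
have [a _ UW] : exists2 a, a \in iota 0 (nu d) &
    U [set r | X r s = upd (X p s) d a].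
  apply: (ultra_cover_seq UU (filterI Np Nq)) => r [[d1 pr] [d2 qr]].
  have d1d := adj_triangle pq pr qr; rewrite d1d in pr.
  exists (X r s d); last exact: adj_upd_eq pr.
  by have [_ _ rd _] := pr; rewrite mem_iota.
(* Almost all conditions share the same point at [s], while two of them are adjacent there. *)
have [r [rW Nr]] := filter_ex (filterI UW UA).
have [t [tW [e [+ _ _ _]]]] := filter_ex (filterI UW Nr).
by rewrite rW tW.
Qed.

End graph_chains.

(** * Parities and bounded antichains *)

Definition parity (L : nat) (x : word) : bool := odd (\sum_(e < L) x e).

(** Adjacent words differ in one coordinate only, where one has 0 and the other 1. *)
Lemma adj_parity L d x y : d < L -> adj (fun=> 2) d x y ->
  parity L x != parity L y.
Proof.
move=> dL [xy x2 y2 xye]; rewrite /parity (bigD1 (Ordinal dL))//=.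
rewrite [in X in _ != X](bigD1 (Ordinal dL))//= !oddD.
rewrite (eq_bigr (fun e : 'I_L => y e)); last first.
  by move=> e /eqP ed; apply: xye => edE; apply: ed; exact/val_inj.
case: (odd (\sum_(_ < _ | _) _)); move: (x d) (y d) xy x2 y2 => [|[|//]] [|[|//]].
all: by [].
Qed.

Section bounded_chains.
Context {R : realType}.
Local Notation cond := (cond R (graph_family (fun=> 2))).

(** Each condition is coloured by the parities of its points, one for each head in [S]. Incompatible
    conditions get different colours. *)
Lemma piece_bounded_antichain m M (S : seq (seq nat)) (B : set cond) n :
  B `<=` piece m M S -> antichain B -> `I_n #<= B -> n <= 2 ^ size S.
Proof.
move=> BS Bac /pcard_leP[g0].
have [g [gB ginj]] : exists g : nat -> cond, (forall i, i < n -> B (g i)) /\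
    (forall i j, i < n -> j < n -> g i = g j -> i = j).
  exists g0; split=> [i iln|i j iln jln gij]; first exact: funS.
  by apply: (@inj _ _ _ g0) => //; rewrite inE.
have [X XS] := @piece_adj R (fun=> 2) m M S.
(* [L] exceeds the directions of the edges chosen for the finitely many pairs. *)
have [||L _ LP] := @exists_uniform_bound _ [seq (i, j) | i <- enum 'I_n, j <- enum 'I_n]
    (fun ij L => ij.1 != ij.2 :> nat -> exists2 s, s \in S & exists2 d, d < L &
      adj (fun=> 2) d (X (g ij.1) s) (X (g ij.2) s)) 0.
- move=> ij L L' LL' h /h[s sS [d dL ijd]]; exists s => //; exists d => //.
  exact: leq_trans LL'.
- move=> [i j] _ /=; have [->|ij] := eqVneq (i : nat) j; first by exists 0.
  have [||gij|s sS [d ijd]] := XS (g i) (g j).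
  + exact/BS/gB.
  + exact/BS/gB.
  + move: gij; apply: Bac; [exact: gB|exact: gB|move=> /ginj ijE].
    by move/eqP: ij; apply; exact: ijE.
  by exists d.+1 => _; exists s => //; exists d.
pose f (i : 'I_n) : {ffun 'I_(size S) -> bool} :=
  [ffun k : 'I_(size S) => parity L (X (g i) (nth [::] S k))].
have /leq_card : injective f.
  move=> i j fij; apply/val_inj/eqP/negPn/negP => ij.
  have [|s sS [d dL ijd]] := LP (i, j) _ ij.
    by apply: allpairs_f; rewrite mem_enum.
  have := adj_parity dL ijd; apply/negP/negPn/eqP.
  have sS' : index s S < size S by rewrite index_mem.
  have /ffunP/(_ (Ordinal sS')) := fij.
  by rewrite !ffunE /= nth_index.
by rewrite card_ord card_ffun card_ord card_bool.
Qed.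

End bounded_chains.

(** * Chain conditions *)

Section cond_classes.
Context {R : realType} {E : nat -> set (seq nat)}.
Hypothesis Ee : edge_family E.
Local Notation cond := (cond R E).

(** Only pieces with [n0 <= m] are enumerated: edges in directions below [n0] may have too few
    points. *)
Definition piece_of (n0 k : nat) : set cond :=
  if unpickle k is Some (m, M, hs) then
    if n0 <= m then piece m M hs else set0
  else set0.

Lemma piece_of_ind (Q : set cond -> Prop) n0 k : Q set0 ->
  (forall m M S, n0 <= m -> Q (piece m M S)) -> Q (piece_of n0 k).
Proof.
move=> Q0 QP; rewrite /piece_of; case: unpickle => [[[m M] S]|//].
by case: ifP => // /QP.
Qed.

Lemma bigcup_piece_of n0 : \bigcup_k piece_of n0 k = setT.
Proof.
apply/seteqP; split=> // p _; have [m [M [S [nm Pp]]]] := exists_piece p n0.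
by exists (pickle (m, M, S)) => //; rewrite /piece_of pickleK nm.
Qed.

Lemma borel_piece_of n0 k : borel (piece_of n0 k).
Proof.
apply: piece_of_ind => [|m M S _]; first exact: sigma_algebra0.
exact: borel_piece.
Qed.

Lemma borel_sigma_linked_cond n n0 :
  (forall d A, n0 <= d -> E d A -> n < size A) -> borel_sigma_n_linked cond n.
Proof.
move=> nE; exists (piece_of n0); split.
- exact: bigcup_piece_of.
- by move=> k; exact: borel_piece_of.
move=> k; apply: piece_of_ind => [B B0 _|m M S nm].
  (* A subset of the empty piece is empty, and any condition bounds it from below. *)
  by exists (fun _ _ => 0) => p /B0.
by apply: piece_linked => // d A md; apply: nE; exact: leq_trans md.
Qed.

Lemma not_borel_sigma_linked_cond n :
  (forall N, exists d A, [/\ N <= d, E d A & size A = n]) ->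
  ~ borel_sigma_n_linked cond n.
Proof.
move=> nE [F [FT bF Fn]]; have [k [N kN]] := borel_cover_not_linked Ee FT bF.
have [d [A [Nd EA sA]]] := nE N; apply: (kN d A Nd EA).
by rewrite sA; exact: Fn.
Qed.

Lemma not_borel_sigma_centred_cond :
  (forall N, exists d A, N <= d /\ E d A) -> ~ borel_sigma_centred cond.
Proof.
move=> nE [F [FT bF Fc]]; have [k [N kN]] := borel_cover_not_linked Ee FT bF.
have [d [A [Nd EA]]] := nE N; apply: (kN d A Nd EA); apply: Fc.
by have [] := Ee EA.
Qed.

End cond_classes.

Section graph_classes.
Context {R : realType}.

Lemma borel_sigma_finite_cc_graph nu :
  borel_sigma_finite_cc (cond R (graph_family nu)).
Proof.
exists (piece_of 0); split.
- exact: bigcup_piece_of.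
- by move=> k; exact: (borel_piece_of (@graph_edge_family nu)).
move=> k B; apply: (piece_of_ind (Q := fun A => B `<=` A -> antichain B -> _)).
  by rewrite subset0 => -> _; apply; exact: finite_set0.
by move=> m M S _; exact: piece_finite_antichain.
Qed.

Lemma antichain_line nu (p : cond R (graph_family nu)) d n : p 0 0 = 1 ->
  n <= nu d -> antichain (upd1 p d @` `I_n).
Proof.
move=> p1 nd _ _ [a an <-] [b bn <-] /= ab; move: (an) (bn) => /= an' bn'.
have ab' : a <> b by move=> abE; apply: ab; rewrite abE.
move=> lab; have nolb := @line_no_lbound R _ (@graph_edge_family nu) p d [:: a; b]
  [set upd1 p d a; upd1 p d b].
apply: nolb => //.
- exists a, b; split=> //; exact: leq_trans nd.
- by move=> c; rewrite !inE => /orP[]/eqP ->; [left|right].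
apply: lab => //.
have -> : [set upd1 p d a; upd1 p d b] =
    (fun i => upd1 p d (nth 0 [:: a; b] i)) @` `I_2.
  apply/seteqP; split=> q /=; first by move=> [->|->]; [exists 0|exists 1].
  by move=> [[|[|//]] _ <-]; [left|right].
apply: inj_card_eq => i j; rewrite !inE /= => i2 j2 /upd1_inj.
by move: i j i2 j2 => [|[|//]] [|[|//]] //= _ _ /esym/ab'.
Qed.

Lemma not_borel_sigma_bounded_cc_graph nu :
  (forall n N, exists2 d, N <= d & n <= nu d) ->
  ~ borel_sigma_bounded_cc (cond R (graph_family nu)).
Proof.
move=> nuP [F [FT bF Fac]].
(* The shift matches the indexing of the pieces from 1. A line in a late direction then gives an
   antichain of size [k.+1] inside [F k.+1]. *)
have [||k [N kN]] := @borel_cover_line R _ (fun k => F k.+1).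
- apply/seteqP; split=> // p _.
  have : (\bigcup_(n in [set n | 0 < n]) F n) p by rewrite FT.
  by move=> [[|k]// _ Fp]; exists k.
- by move=> k; exact: bF.
have [d Nd kd] := nuP k.+1 N; have [p p1 Fp] := kN d Nd.
apply: (Fac k.+1 _ (upd1 p d @` `I_k.+1)) => //.
- by move=> _ [a _ <-].
- exact: antichain_line.
have : upd1 p d @` `I_k.+1 #= `I_k.+1.
  by apply: inj_card_eq => a b _ _; exact: upd1_inj.
by rewrite card_eq_le => /andP[].
Qed.

(** Every code [a] occurs as the exponent of 2 in arbitrarily large numbers, so a piece can be
    placed at an index beyond its bound on antichains. *)
Lemma exists_logn2 a b : exists2 n, b < n & logn 2 n = a.
Proof.
exists (2 ^ a * 3 ^ b); last first.
  by rewrite lognM ?expn_gt0// pfactorK// lognX muln0 addn0.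
by rewrite (leq_trans (ltn_expl b (isT : 1 < 3)))// leq_pmull// expn_gt0.
Qed.

Lemma borel_sigma_bounded_cc_graph :
  borel_sigma_bounded_cc (cond R (graph_family (fun=> 2))).
Proof.
(* The exponent of 2 in [n] names the piece, which is kept only when [n] exceeds the bound on its
   antichains. *)
pose F n : set (cond R (graph_family (fun=> 2))) :=
  if unpickle (logn 2 n) is Some (m, M, hs) then
    if 2 ^ size (hs : seq (seq nat)) < n then piece m M hs else set0
  else set0.
exists F; split.
- apply/seteqP; split=> // p _; have [m [M [S [_ Pp]]]] := exists_piece p 0.
  have [n Sn nE] := exists_logn2 (pickle (m, M, S)) (2 ^ size S).
  by exists n; [exact: leq_ltn_trans Sn|rewrite /F nE pickleK Sn].
- move=> n _; rewrite /F.
  case: unpickle => [[[m M] S]|]; last exact: sigma_algebra0.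
  case: ifP => _; last exact: sigma_algebra0.
  exact: (borel_piece (@graph_edge_family _)).
have F0 n (B : set (cond R (graph_family (fun=> 2)))) : 0 < n ->
    B `<=` set0 -> ~ (`I_n #<= B).
  by rewrite subset0 => n0 ->; rewrite card_le0 => /eqP/seteqP[/(_ 0 n0)].
move=> n n0 B; rewrite /F.
case: unpickle => [[[m M] S]|]; last by move=> /F0 + _; exact.
case: ifP => [Sn BS Bac nB|_]; last by move=> /F0 + _; exact.
by have := piece_bounded_antichain BS Bac nB; rewrite leqNgt Sn.
Qed.

End graph_classes.

(** * Full lines and the four examples *)

Definition line_family (nu : nat -> nat) (d : nat) : set (seq nat) :=
  [set iota 0 (nu d)].

Lemma line_edge_family nu : (forall d, 1 < nu d) -> edge_family (line_family nu).
Proof. by move=> nu1 d _ ->; rewrite iota_uniq size_iota. Qed.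

Theorem theorem3 (R : realType) :
  [/\ exists (d : Order.disp_t) (P : POrderedTopological.type d),
        [/\ borel_poset R P, borel_sigma_finite_cc P &
            ~ borel_sigma_bounded_cc P],
      exists (d : Order.disp_t) (P : POrderedTopological.type d),
        [/\ borel_poset R P, borel_sigma_bounded_cc P &
            ~ borel_sigma_n_linked P 2],
      forall n : nat, 2 < n ->
        exists (d : Order.disp_t) (P : POrderedTopological.type d),
          [/\ borel_poset R P, borel_sigma_n_linked P (n - 1) &
              ~ borel_sigma_n_linked P n] &
      exists (d : Order.disp_t) (P : POrderedTopological.type d),
        [/\ borel_poset R P, (forall n : nat, 2 <= n -> borel_sigma_n_linked P n) &
            ~ borel_sigma_centred P]].
Proof.
split.
- exists Order.default_display, (cond R (graph_family (fun d => d.+2))); split.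
  + exact/borel_poset_cond/graph_edge_family.
  + exact: borel_sigma_finite_cc_graph.
  apply: not_borel_sigma_bounded_cc_graph => n N.
  exists (maxn n N); first exact: leq_maxr.
  by rewrite (leq_trans (leq_maxl n N))// -addn2 leq_addr.
- exists Order.default_display, (cond R (graph_family (fun=> 2))); split.
  + exact/borel_poset_cond/graph_edge_family.
  + exact: borel_sigma_bounded_cc_graph.
  apply: not_borel_sigma_linked_cond; first exact: graph_edge_family.
  by move=> N; exists N, [:: 0; 1]; split=> //; exists 0, 1.
- move=> n n2; exists Order.default_display, (cond R (line_family (fun=> n))).
  have Ee : edge_family (line_family (fun=> n)).
    by apply: line_edge_family => _; exact: ltnW.
  split; first exact: borel_poset_cond.
  + apply: (@borel_sigma_linked_cond _ _ Ee _ 0) => d _ _ ->.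
    by rewrite size_iota subn1 ltn_predL (leq_trans _ n2).
  apply: not_borel_sigma_linked_cond => // N; exists N, (iota 0 n).
  by split=> //; exact: size_iota.
- exists Order.default_display, (cond R (line_family (fun d => d.+2))).
  have Ee : edge_family (line_family (fun d => d.+2)) by exact: line_edge_family.
  split; first exact: borel_poset_cond.
  (* For given [n], the pieces with [n <= m] only meet edges in directions [d >= n], which have
     [d + 2 > n] points. *)
  + move=> n _; apply: (@borel_sigma_linked_cond _ _ Ee n n) => d _ nd ->.
    by rewrite size_iota ltnS (leq_trans nd).
  apply: not_borel_sigma_centred_cond => // N.
  by exists N, (iota 0 N.+2).
Qed.
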